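(* Let $L_1$ and $L_2$ be finite meet-semilattices, $P$ a finite poset, and $F_1 \supseteq F_2$ filters of $P$. Let $f : L_1 \to \mathrm{Sub}(L_2)$ be a meet-concave map such that for every $u, v \in L_1$ with $u \leq v$, $f(u) \supseteq f(v)$. Let $a$ be a join-irreducible of $L_1$, and let $\underline{\iota}_1(a)$ denote the least element of $f(a)$. If there is a decreasing matching $\sigma : \mathrm{T}(L_1^P, F_1, a) \to \mathrm{T}(L_1^P, F_2, a)$, then there is a decreasing matching $$\sigma' : \mathrm{T}\big((L_1 \bowtie_f L_2)^P, F_1, \langle a, \underline{\iota}_1(a)\rangle\big) \to \mathrm{T}\big((L_1 \bowtie_f L_2)^P, F_2, \langle a, \underline{\iota}_1(a)\rangle\big).$$
   Context: $\mathrm{Sub}(L_2)$ is the family of (non-empty) meet-subsemilattices of $L_2$. For $A, B \in \mathrm{Sub}(L_2)$, $A \wedge B = \{u \wedge v \mid u \in A, v \in B\}$. A map $f : L_1 \to \mathrm{Sub}(L_2)$ is meet-concave iff $f(u) \wedge f(v) \subseteq f(u \wedge v)$ for all $u, v \in L_1$. For such $f$, $L_1 \bowtie_f L_2 = \{\langle u, v\rangle \in L_1 \times L_2 \mid v \in f(u)\}$, a meet-subsemilattice of the product $L_1 \times L_2$. In a meet-semilattice, an element $a$ is join-irreducible iff whenever $a$ is the least upper bound of $v$ and $w$, $a = v$ or $a = w$. For a meet-semilattice $L$, $L^P$ is the set of order-preserving maps from $P$ to $L$, ordered pointwise. A filter of $P$ is an up-closed subset (possibly empty). For a filter $F$ of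 $P$ and $b \in L$, $\mathrm{T}(L^P, F, b) = \{g \in L^P \mid \text{for all } x \in P:\ g(x) \geq b \text{ iff } x \in F\}$. A decreasing matching from $Q_1$ to $Q_2$ (subsets of a poset) is a one-to-one map $\sigma: Q_1 \to Q_2$ with $\sigma(x) \leq x$ for all $x \in Q_1$. *)

(* Defs.v *)
From HB Require Import structures.
From mathcomp Require Import all_boot all_order.

Set Implicit Arguments.
Unset Strict Implicit.
Unset Printing Implicit Defensive.

Import Order.TTheory.
Local Open Scope order_scope.

Section JoinIrreducible.
Variables (d : Order.disp_t) (L : porderType d).

Definition is_lub (a v w : L) : Prop :=
  [/\ v <= a, w <= a & forall c, v <= c -> w <= c -> a <= c].

(* A least element, if any, is join-irreducible in this sense. *)
Definition join_irreducible (a : L) : Prop :=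
  forall v w, is_lub a v w -> a = v \/ a = w.

Definition is_filter (T : finPOrderType d) (F : {set T}) : Prop :=
  forall x y, x \in F -> x <= y -> y \in F.

(* The matching is the restriction to Q1 of a total function; its values
   outside Q1 are irrelevant. *)
Definition decreasing_matching (T : finPOrderType d) (Q1 Q2 : {set T})
    (sigma : T -> T) : Prop :=
  [/\ {in Q1, forall x, sigma x \in Q2},
      {in Q1 &, injective sigma} &
      {in Q1, forall x, sigma x <= x}].

End JoinIrreducible.

Section SubSemilattices.
Variables (d : Order.disp_t) (L : finMeetSemilatticeType d).

Definition set_meet (A B : {set L}) : {set L} :=
  [set u `&` v | u in A, v in B].

Definition subsemilattice_pred (A : {set L}) : bool :=
  (A != set0) && [forall u in A, forall v in A, u `&` v \in A].

Record subsemilattice : Type := Subsemilattice {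
  subsemilattice_set :> {set L};
  _ : subsemilattice_pred subsemilattice_set }.

HB.instance Definition _ := [isSub for subsemilattice_set].
HB.instance Definition _ := [Finite of subsemilattice by <:].

Lemma subsemilattice_neq0 (A : subsemilattice) : A != set0 :> {set L}.
Proof. by case/andP: (valP A). Qed.

Lemma subsemilattice_meet (A : subsemilattice) :
  {in A &, forall u v, u `&` v \in A}.
Proof.
move=> u v uA vA; case/andP: (valP A) => _ /forall_inP /(_ u uA).
by move/forall_inP; apply.
Qed.

Lemma least_ex (A : subsemilattice) :
  exists x, (x \in A) && [forall y in A, x <= y].
Proof.
have [x0 x0A] := set0Pn _ (subsemilattice_neq0 A).
have [x xA xmin] : exists2 x, x \in A & {in enum A, forall y, x <= y}.
  have : {subset enum A <= A} by move=> y; rewrite mem_enum.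
  elim: (enum A) => [|y s IHs] sA; first by exists x0.
  have [z zs|x xA xs] := IHs; first by apply: sA; rewrite inE zs orbT.
  have yA : y \in A by apply: sA; rewrite inE eqxx.
  exists (y `&` x); first exact: subsemilattice_meet.
  move=> z; rewrite inE => /predU1P[-> | zs]; first exact: leIl.
  exact: le_trans (leIr _ _) (xs z zs).
exists x; rewrite xA; apply/forall_inP => y yA.
by apply: xmin; rewrite mem_enum.
Qed.

Definition least (A : subsemilattice) : L := xchoose (least_ex A).

Lemma least_in (A : subsemilattice) : least A \in A.
Proof. by case/andP: (xchooseP (least_ex A)). Qed.

Lemma least_le (A : subsemilattice) : {in A, forall y, least A <= y}.
Proof. by case/andP: (xchooseP (least_ex A)) => _ /forall_inP. Qed.

End SubSemilattices.

Section Bowtie.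
Variables (d1 d2 : Order.disp_t).
Variables (L1 : finMeetSemilatticeType d1) (L2 : finMeetSemilatticeType d2).
Variable f : L1 -> subsemilattice L2.

Definition meet_concave : Prop :=
  forall u v, set_meet (f u) (f v) \subset f (u `&` v).

(* [L1 *p L2] is the cartesian product with the componentwise order. *)
Record bowtie : Type := Bowtie {
  bowtie_pair :> L1 *p L2;
  _ : bowtie_pair.2 \in f bowtie_pair.1 }.

HB.instance Definition _ := [isSub for bowtie_pair].
HB.instance Definition _ := [Finite of bowtie by <:].
HB.instance Definition _ :=
  [SubChoice_isSubPOrder of bowtie by <: with Order.prod_display d1 d2].

Lemma bowtie_leE (p q : bowtie) :
  (p <= q) = ((val p).1 <= (val q).1) && ((val p).2 <= (val q).2).
Proof. by []. Qed.

Lemma bowtie_meet_closed (p q : L1 *p L2) : meet_concave ->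
  p.2 \in f p.1 -> q.2 \in f q.1 ->
  (Order.meet p q).2 \in f (Order.meet p q).1.
Proof.
move=> fcv pf qf; apply: (subsetP (fcv p.1 q.1)).
by apply/imset2P; exists p.2 q.2.
Qed.

Definition bowtie_least (u : L1) : bowtie :=
  @Bowtie (u, least (f u)) (least_in (f u)).

End Bowtie.

Section MonotoneMaps.
Variables (dP d : Order.disp_t) (P : finPOrderType dP) (L : finPOrderType d).

Definition monotone_pred (g : {ffun P -> L}) : bool :=
  [forall x, forall y, (x <= y) ==> (g x <= g y)].

Record monotone_map : Type := MonotoneMap {
  monotone_fun :> {ffun P -> L};
  _ : monotone_pred monotone_fun }.

HB.instance Definition _ := [isSub for monotone_fun].
HB.instance Definition _ := [Finite of monotone_map by <:].

Definition monotone_le (g h : monotone_map) : bool := [forall x, g x <= h x].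

Fact monotone_le_refl : reflexive monotone_le.
Proof. by move=> g; apply/forallP. Qed.

Fact monotone_le_anti : antisymmetric monotone_le.
Proof.
move=> g h /andP[/forallP gh /forallP hg]; apply/val_inj/ffunP => x.
by apply/le_anti; rewrite gh hg.
Qed.

Fact monotone_le_trans : transitive monotone_le.
Proof.
move=> h g k /forallP gh /forallP hk; apply/forallP => x.
exact: le_trans (gh x) (hk x).
Qed.

HB.instance Definition _ := Order.Le_isPOrder.Build d monotone_map
  monotone_le_refl monotone_le_anti monotone_le_trans.

Lemma monotone_leP (g h : monotone_map) :
  reflect (forall x, g x <= h x) (g <= h).
Proof. exact: forallP. Qed.

Definition Tset (F : {set P}) (b : L) : {set monotone_map} :=
  [set g : monotone_map | [forall x, (b <= g x) == (x \in F)]].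

End MonotoneMaps.

Arguments Tset {dP d P} L F b.

(* Main.v *)
(** Since [f] is antitone, [v \in f u] and [a <= u] force [least (f a) <= v],
    so membership of a monotone map [<g1, g2>] in [Tset] depends on [g1] only.
    As [sigma g1 <= g1], antitonicity also makes [<sigma g1, g2>] a map into
    the bowtie, and [<g1, g2> |-> <sigma g1, g2>] is the required matching. *)
Require Import Defs.
From mathcomp Require Import all_boot all_order.
Import Order.TTheory.
Local Open Scope order_scope.

Section MonotoneBowtie.
Set Implicit Arguments.
Unset Strict Implicit.

Context {d1 d2 dP : Order.disp_t}.
Context {L1 : finMeetSemilatticeType d1} {L2 : finMeetSemilatticeType d2}.
Context {P : finPOrderType dP} {f : L1 -> subsemilattice L2}.
Context (f_antitone : forall u v : L1, u <= v -> f v \subset f u).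

Implicit Types (g : monotone_map P (bowtie f)) (h : monotone_map P L1).

Lemma monotone_mapP {d} {L : finPOrderType d} (k : monotone_map P L) x y :
  x <= y -> k x <= k y.
Proof. by case: k => k /= /forallP/(_ x)/forallP/(_ y)/implyP. Qed.

Lemma bowtie_least_leE (a : L1) (p : bowtie f) :
  (bowtie_least f a <= p) = (a <= (val p).1).
Proof.
rewrite bowtie_leE /=; case: (boolP (a <= _)) => //= a_le.
apply: least_le; apply: (subsetP (f_antitone a_le)).
exact: (valP p).
Qed.

Lemma monotone_fst_subproof g :
  monotone_pred [ffun x => (val (g x)).1].
Proof.
apply/forallP => x; apply/forallP => y; apply/implyP => /(monotone_mapP g).
by rewrite bowtie_leE !ffunE => /andP[].
Qed.

Definition monotone_fst g : monotone_map P L1 :=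
  MonotoneMap (monotone_fst_subproof g).

Lemma monotone_fstE g x : monotone_fst g x = (val (g x)).1.
Proof. by rewrite ffunE. Qed.

(** Used for both filters, this turns membership in the bowtie into membership of the first
    projection, where the properties of [sigma] apply. *)
Lemma mem_Tset_bowtie (F : {set P}) (a : L1) g :
  (g \in Tset (bowtie f) F (bowtie_least f a)) =
  (monotone_fst g \in Tset L1 F a).
Proof.
by rewrite !inE; apply: eq_forallb => x; rewrite bowtie_least_leE monotone_fstE.
Qed.

(* Meaningful only when [h <= monotone_fst g]; both [insubd] defaults are
   otherwise junk. *)
Definition replace_fst g h : monotone_map P (bowtie f) :=
  insubd g [ffun x => insubd (g x) ((h x, (val (g x)).2) : L1 *p L2)].

(** Neither [insubd] takes its default: antitonicity gives [f (val (g x)).1 \subset f (h x)], so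
    each new pair lies in the bowtie, and the new map is monotone. *)
Lemma replace_fstE g h x : h <= monotone_fst g ->
  val (replace_fst g h x) = (h x, (val (g x)).2).
Proof.
move=> /monotone_leP h_le.
have valE y : val (insubd (g y) ((h y, (val (g y)).2) : L1 *p L2)) =
              (h y, (val (g y)).2).
  rewrite insubdK // unfold_in /=.
  apply: (subsetP (f_antitone (h_le y))).
  by rewrite monotone_fstE; exact: (valP (g y)).
(* Refolding the coercion into [val] lets [insubdK] reach the outer [insubd]; monotonicity of the
   new map remains, inherited from [h] in the first coordinate and from [g] in the second. *)
rewrite /replace_fst -[monotone_fun _]/(val _) insubdK ?ffunE //.
apply/forallP => y; apply/forallP => z; apply/implyP => yz.
rewrite !ffunE bowtie_leE !valE /= monotone_mapP //=.
by have := monotone_mapP g yz; rewrite bowtie_leE => /andP[].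
Qed.

Lemma monotone_fst_replace g h : h <= monotone_fst g ->
  monotone_fst (replace_fst g h) = h.
Proof.
by move=> h_le; apply/val_inj/ffunP => x; rewrite monotone_fstE replace_fstE.
Qed.

Lemma replace_fst_le g h : h <= monotone_fst g -> replace_fst g h <= g.
Proof.
move=> h_le; apply/monotone_leP => x; rewrite bowtie_leE replace_fstE //= lexx.
by rewrite andbT -monotone_fstE; exact: (monotone_leP _ _ h_le).
Qed.

End MonotoneBowtie.

Theorem theorem4p5p8
  (d1 d2 dP : Order.disp_t)
  (L1 : finMeetSemilatticeType d1) (L2 : finMeetSemilatticeType d2)
  (P : finPOrderType dP) (F1 F2 : {set P})
  (F1_filter : is_filter F1) (F2_filter : is_filter F2)
  (F2_sub_F1 : F2 \subset F1)
  (f : L1 -> subsemilattice L2)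
  (f_concave : meet_concave f)
  (f_antitone : forall u v : L1, u <= v -> f v \subset f u)
  (a : L1) (a_irr : join_irreducible a) :
  (exists sigma : monotone_map P L1 -> monotone_map P L1,
     decreasing_matching (Tset L1 F1 a) (Tset L1 F2 a) sigma) ->
  exists sigma' : monotone_map P (bowtie f) -> monotone_map P (bowtie f),
    decreasing_matching (Tset (bowtie f) F1 (bowtie_least f a))
                        (Tset (bowtie f) F2 (bowtie_least f a)) sigma'.
Proof.
case=> sigma [sigma_T sigma_inj sigma_le].
exists (fun g => replace_fst g (sigma (monotone_fst g))).
split=> [g | g k | g]; rewrite !(mem_Tset_bowtie f_antitone) // => gT.
- by rewrite (monotone_fst_replace f_antitone) ?sigma_T ?sigma_le.
(* The first projections of the two images are [sigma (monotone_fst g)] and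
   [sigma (monotone_fst k)], so injectivity of [sigma] recovers the original ones. *)
- move=> kT eq_gk; have fst_gk : monotone_fst g = monotone_fst k.
    apply: sigma_inj => //; move/(congr1 monotone_fst): eq_gk.
    by rewrite !(monotone_fst_replace f_antitone) ?sigma_le.
  apply/val_inj/ffunP => x; apply/val_inj.
  have fstE : (val (g x)).1 = (val (k x)).1 by rewrite -!monotone_fstE fst_gk.
  (* Second coordinates are untouched by the replacement, hence can be read off the images. *)
  have := congr1 (fun m : monotone_map P (bowtie f) => (val (m x)).2) eq_gk.
  rewrite !(replace_fstE f_antitone) ?sigma_le //= => sndE.
  by rewrite [LHS]surjective_pairing [RHS]surjective_pairing fstE sndE.
- exact/(replace_fst_le f_antitone)/sigma_le.
Qed.
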